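(* Let $T\in\mathcal{B}(\mathcal{H})$, $T\neq0$, with $\mathrm{Re}(T)=\frac{T+T^*}{2}\ge sI$ for some $s>0$. Then $T$ is invertible and $T^{-1}\in\mathcal{A}_{2s}$.
   Context: $\mathcal{H}$ is a separable nontrivial complex Hilbert space, $\mathcal{B}(\mathcal{H})$ is the algebra of bounded linear operators on $\mathcal{H}$ with the operator norm, and $I$ is the identity operator. For self-adjoint $A,B$, $A\ge B$ means $\langle(A-B)x,x\rangle\ge0$ for all $x\in\mathcal{H}$. For $\alpha\in\mathbb{C}\setminus\{0\}$, $\mathcal{A}_\alpha=\{S\in\mathcal{B}(\mathcal{H}):\|\alpha S-I\|\le1\}$. *)

(* Defs.v *)
From mathcomp Require Import all_boot all_order all_algebra.
From mathcomp Require Import complex.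
From mathcomp Require Import all_classical all_reals all_analysis.

Set Implicit Arguments.
Unset Strict Implicit.
Unset Printing Implicit Defensive.

Import Order.TTheory GRing.Theory Num.Theory.
Import numFieldNormedType.Exports.

Local Open Scope classical_set_scope.
Local Open Scope ring_scope.
Local Open Scope complex_scope.

Definition separable_space (T : topologicalType) : Prop :=
  exists2 D : set T, countable D & dense D.

(* A complex Hilbert space is a complete normed space over R[i] together with
   a positive definite Hermitian form, linear in its first argument, that
   induces the norm. *)
Definition induces_norm (R : realType) (H : normedModType R[i])
    (dot : {dot H for Num.conj}) : Prop :=
  forall x : H, `|x| ^+ 2 = dot x x.

Section Operators.
Context {R : realType} {H : normedModType R[i]}.
Implicit Types A B S T : H -> H.

Definition bounded_operators : set (H -> H) :=
  [set T | linear T /\ bounded_near T (nbhs (0 : H))].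

(* The norm of H takes its values in R[i] (they are real and nonnegative), hence
   the projection to R. The supremum is meaningful on bounded operators only:
   sup is 0 on sets without an upper bound. *)
Definition opnorm T : R :=
  sup [set complex.Re `|T x| | x in [set x : H | `|x| <= 1]].

Definition is_inverse T S : Prop :=
  [/\ bounded_operators S, cancel T S & cancel S T].

Definition invertible T : Prop := exists S, is_inverse T S.

Definition op_inv T : H -> H := xget 0 [set S | is_inverse T S].

Definition calA (alpha : R[i]) : set (H -> H) :=
  [set S | bounded_operators S /\ opnorm (alpha *: S - idfun) <= 1].

Variable dot : {dot H for Num.conj}.

Definition is_adjoint T S : Prop :=
  bounded_operators S /\ forall x y, dot (T x) y = dot x (S y).

(* By the Riesz representation theorem a bounded operator on a Hilbert space
   has exactly one adjoint; the default value 0 is never used there. *)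
Definition adjoint T : H -> H := xget 0 [set S | is_adjoint T S].

Definition op_Re T : H -> H := 2^-1 *: (T + adjoint T).

(* In R[i], 0 <= z means that z is real and nonnegative. *)
Definition op_ge A B : Prop := forall x, 0 <= dot ((A - B) x) x.

End Operators.

(* Main.v *)
From HB Require Import structures.
Require Import Defs.
From mathcomp Require Import all_boot all_order all_algebra.
From mathcomp Require Import complex.
From mathcomp Require Import all_classical all_reals all_analysis.
From mathcomp Require Import ring lra.

Import Order.TTheory GRing.Theory Num.Theory.
Import numFieldNormedType.Exports.

Local Open Scope classical_set_scope.
Local Open Scope ring_scope.
Local Open Scope complex_scope.

(** The hypothesis on Re T says that T is coercive:
    Re <T x, x> >= s |x|^2 ([op_Re_coercive]).  Both claims follow from this
    and from the expansion of |a x - y|^2 for real a ([rnormZB]).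

    Taking a = 2 s and y = T x,
      |2 s x - T x|^2 = |T x|^2 - 4 s (Re <T x, x> - s |x|^2) <= |T x|^2.
    For x = T^-1 z this reads |(2 s T^-1 - I) z| <= |z|, which is membership of
    T^-1 in A_{2s}.  By the triangle inequality it also gives
    2 s |x| <= 2 |T x|, so T is injective and an inverse of T is bounded by
    1 / s ([coercive_bounded_below]).

    It remains to solve T x = y, as in the proof of the Lax-Milgram theorem
    ([coercive_surjective]).  The solutions are the fixed points of
    x |-> x - r (T x - y).  If |T x| <= K |x| and r = s / K^2, the same
    expansion bounds the square of the Lipschitz constant of this map by
      1 - 2 r s + r^2 K^2 = 1 - s r < 1,
    so the contraction principle applies ([contraction_has_fixpoint]). *)

Section RealValuedNorm.
Context {R : realType} {V : normedModType R[i]}.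
Implicit Types x y : V.

(** The norm of [V] lies in [R[i]], whose order is only partial; its real part
    carries the same information in the totally ordered field [R]. *)
Definition rnorm x : R := complex.Re `|x|.

Lemma rnormE x : `|x| = (rnorm x)%:C.
Proof. by rewrite /rnorm RRe_real ?ger0_real. Qed.

Lemma rnorm_ge0 x : 0 <= rnorm x.
Proof. by rewrite -ler0c -rnormE normr_ge0. Qed.

Lemma rnorm_le0 x : rnorm x <= 0 -> x = 0.
Proof. by rewrite -lecR -rnormE normr_le0 => /eqP. Qed.

Lemma ler_rnormD x y : rnorm (x + y) <= rnorm x + rnorm y.
Proof. by rewrite -lecR rmorphD/= -!rnormE ler_normD. Qed.

Lemma rnormN x : rnorm (- x) = rnorm x.
Proof. by rewrite /rnorm normrN. Qed.

Lemma rnormZ (a : R) x : 0 <= a -> rnorm (a%:C *: x) = a * rnorm x.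
Proof.
by move=> a0; rewrite [LHS]/rnorm normrZ ger0_norm ?ler0c// rnormE -rmorphM.
Qed.

End RealValuedNorm.

(** The contraction principle for modules normed by [R[i]].  The iterates from 0
    satisfy |u_0 - u_m| <= C for the solution C of d + q C = C, where
    d = |u_0 - u_1|; applying f n times gives |u_n - u_(n+m)| <= q^n C. *)
Lemma contraction_has_fixpoint (R : realType) (X : completeNormedModType R[i])
    (f : X -> X) (q : R) :
  0 <= q < 1 -> (forall x y, rnorm (f x - f y) <= q * rnorm (x - y)) ->
  exists p, f p = p.
Proof.
move=> /andP[q0 q1] fq; pose u n := iter n f 0.
pose d := rnorm (u 0%N - u 1%N); pose C := d / (1 - q).
have q1' : 1 - q != 0 by rewrite subr_eq0 gt_eqF.
have CE : d + q * C = C by rewrite /C; field.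
have dist0 m : rnorm (u 0%N - u m) <= C.
  elim: m => [|m ih].
    by rewrite subrr /rnorm normr0 divr_ge0 ?rnorm_ge0 ?subr_ge0 ?ltW.
  have -> : u 0%N - u m.+1 = (u 0%N - u 1%N) + (u 1%N - u m.+1).
    by rewrite addrA subrK.
  rewrite (le_trans (ler_rnormD _ _))// -CE lerD2l (le_trans (fq _ _))//.
  by rewrite ler_wpM2l.
have dist n m : rnorm (u n - u (n + m)%N) <= q ^+ n * C.
  elim: n => [|n ih]; first by rewrite expr0 mul1r dist0.
  by rewrite (le_trans (fq _ _))// exprS -mulrA ler_wpM2l.
have cvgu : cvg (u @ \oo).
  apply/cauchy_cvgP; apply: cauchy_exP => e e0.
  have eE : e = (complex.Re e)%:C by rewrite RRe_real// gtr0_real.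
  have Re0 : 0 < complex.Re e by rewrite -ltcR -eE.
  have : geometric C q n @[n --> \oo] --> 0.
    by apply: cvg_geometric; rewrite ger0_norm.
  move=> /cvgrPdist_lt/(_ _ Re0)[N _ /(_ N (leqnn N))/=].
  rewrite sub0r normrN => /(le_lt_trans (ler_norm _)); rewrite mulrC => CN.
  exists (u N); exists N => // n /= Nn.
  rewrite -ball_normE/= rnormE eE ltcR (le_lt_trans _ CN)//.
  by rewrite -(subnKC Nn) dist.
exists (lim (u @ \oo)).
(* The shifted sequence u_(n+1) = f (u_n) converges both to f (lim u), since f is
   Lipschitz, and to lim u. *)
have fu : u n.+1 @[n --> \oo] --> f (lim (u @ \oo)).
  apply/cvgrPdist_lt => e e0.
  move/cvgrPdist_lt: cvgu => /(_ e e0); apply: filterS => n.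
  apply: le_lt_trans; rewrite !rnormE lecR (le_trans (fq _ _))//.
  by rewrite ler_piMl ?rnorm_ge0 ?ltW.
apply: (cvg_unique (@norm_hausdorff _ _)) fu _.
by rewrite /= (cvg_shiftS u).
Qed.

Lemma Re_conj (R : realType) (z : R[i]) : complex.Re z^* = complex.Re z.
Proof. by case: z. Qed.

Section Coercive.
Context {R : realType} {H : completeNormedModType R[i]}.
Context (dot : {dot H for Num.conj}) (dot_norm : induces_norm dot).
Implicit Types x y : H.

Definition rdot x y : R := complex.Re (dot x y).

Lemma rdotC x y : rdot x y = rdot y x.
Proof. by rewrite /rdot hermC expr0 mul1r; exact: Re_conj. Qed.

Lemma rdotxx x : rdot x x = rnorm x ^+ 2.
Proof. by rewrite /rdot -dot_norm rnormE -rmorphXn. Qed.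

Lemma rnormZB (a : R) x y :
  rnorm (a%:C *: x - y) ^+ 2 =
  a ^+ 2 * rnorm x ^+ 2 - 2 * a * rdot x y + rnorm y ^+ 2.
Proof.
rewrite -!rdotxx; set u := a%:C *: x.
have uE z : dot u z = a%:C * dot x z by rewrite linearZl_LR.
have ux z : rdot u z = a * rdot x z.
  by rewrite /rdot uE; case: (dot x z) => ? ? /=; ring.
have -> : rdot (u - y) (u - y) = rdot u u + rdot y y - 2 * rdot u y.
  rewrite /rdot dnormB /=.
  case: (dot u u) (dot y y) (dot u y) => a1 b1 [a2 b2] [a3 b3] /=; ring.
have -> : rdot u u = a ^+ 2 * rdot x x by rewrite ux rdotC ux; ring.
rewrite ux; ring.
Qed.

(** When T has an adjoint S, <S x, x> and <T x, x> have the same real part, so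
    Re <(Re T) x, x> = Re <T x, x>.  When T has none, [adjoint] is 0 by
    convention, [op_Re] is T / 2, and the hypothesis yields the stronger bound
    2 s |x|^2 <= Re <T x, x>. *)
Lemma op_Re_coercive (T : H -> H) (s : R) :
  0 < s -> op_ge dot (op_Re dot T) (s%:C *: idfun) ->
  forall x, s * rnorm x ^+ 2 <= rdot (T x) x.
Proof.
move=> s0 ReT x.
have sx0 : 0 <= s * rnorm x ^+ 2 by rewrite mulr_ge0 ?sqr_ge0// ltW.
have : 2 * (s * rnorm x ^+ 2) <= rdot (T x) x + rdot (adjoint dot T x) x.
  have := ReT x; rewrite /op_Re.
  have -> : (2^-1 *: (T + adjoint dot T) - s%:C *: idfun) x =
    2^-1 *: (T x + adjoint dot T x) - s%:C *: x by [].
  rewrite linearBl !linearZl_LR/= linearDl -dot_norm rnormE -rmorphXn/=.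
  have -> : (2^-1 : R[i]) = (2^-1 : R)%:C by rewrite fmorphV rmorph_nat.
  rewrite /rdot lecE => /andP[_].
  case: (dot (T x) x) (dot (adjoint dot T x) x) => a b [c d] /=.
  lra.
rewrite /adjoint; case: xgetP => [S _ [_ TS]|_].
  rewrite (rdotC (S x)) {2}/rdot -TS -/(rdot _ _); lra.
by rewrite {2}/rdot linear0l/=; lra.
Qed.

Context (T : H -> H) (T_bounded : bounded_operators T) (s : R) (s_gt0 : 0 < s)
  (T_coercive : forall x, s * rnorm x ^+ 2 <= rdot (T x) x).

(** The estimate behind both claims: at x = T^-1 y it bounds 2 s T^-1 - I by 1. *)
Lemma coercive_rnorm_le x : rnorm ((2 * s)%:C *: x - T x) <= rnorm (T x).
Proof.
rewrite -(@ler_pXn2r _ 2) ?nnegrE ?rnorm_ge0// rnormZB rdotC.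
have := ler_wpM2l (ltW s_gt0) (T_coercive x); lra.
Qed.

Lemma coercive_bounded_below x : s * rnorm x <= rnorm (T x).
Proof.
have := ler_rnormD ((2 * s)%:C *: x - T x) (T x).
rewrite subrK rnormZ; last by rewrite mulr_ge0 ?ltW.
have := coercive_rnorm_le x; lra.
Qed.

Lemma coercive_surjective y : exists x, T x = y.
Proof.
have [T_lin T_bnd] := T_bounded.
pose Tl : {linear H -> H} := HB.pack T (GRing.isLinear.Build _ _ _ _ T T_lin).
have TB a b : T (a - b) = T a - T b := linearB Tl a b.
have [M M_gt0 TM] : exists2 M : R, 0 < M & forall x, rnorm (T x) <= M * rnorm x.
  have /pinfty_ex_gt0[c c0 Tc] := (linear_boundedP Tl).1 T_bnd.
  have cE : c = (complex.Re c)%:C by rewrite RRe_real// gtr0_real.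
  exists (complex.Re c) => [|x]; first by rewrite -ltcR -cE.
  by rewrite -lecR rmorphM/= -cE -!rnormE.
(* Any bound of T will do; adding s to it makes s r <= 1, so that 1 - s r is the
   square of a real number q. *)
pose K := M + s; pose r := s / K ^+ 2.
have K_gt0 : 0 < K by rewrite addr_gt0.
have r_gt0 : 0 < r by rewrite divr_gt0// exprn_gt0.
pose q := Num.sqrt (1 - s * r).
have sr0 : 0 < s * r <= 1.
  rewrite mulr_gt0//= /r mulrA -expr2 ler_pdivrMr ?exprn_gt0// mul1r.
  by rewrite ler_pXn2r ?nnegrE ?ltW// /K ltrDr.
have q2 : q ^+ 2 = 1 - s * r by rewrite sqr_sqrtr; lra.
have q01 : 0 <= q < 1.
  by rewrite sqrtr_ge0/= -(@ltr_pXn2r _ 2) ?nnegrE ?sqrtr_ge0// q2; lra.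
pose f x := x - r%:C *: (T x - y).
have [|p fp] := @contraction_has_fixpoint _ _ f _ q01.
  move=> a b.
  have -> : f a - f b = - (r%:C *: T (a - b) - (a - b)).
    rewrite /f TB [RHS]opprB opprD addrACA -opprD -scalerBr.
    by rewrite opprB addrA subrK.
  rewrite rnormN -(@ler_pXn2r _ 2) ?nnegrE ?mulr_ge0 ?rnorm_ge0//; last first.
    by case/andP: q01.
  rewrite rnormZB [(q * _) ^+ 2]exprMn q2.
  have := T_coercive (a - b).
  have TK : rnorm (T (a - b)) ^+ 2 <= K ^+ 2 * rnorm (a - b) ^+ 2.
    rewrite -exprMn ler_pXn2r ?nnegrE ?mulr_ge0 ?rnorm_ge0 ?(ltW K_gt0)//.
    by rewrite (le_trans (TM _))// ler_wpM2r ?rnorm_ge0// /K lerDl ltW.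
  have rK : r * K ^+ 2 = s by rewrite /r divfK// expf_neq0// gt_eqF.
  move=> /(ler_wpM2l (ltW r_gt0)).
  have := ler_wpM2l (sqr_ge0 r) TK.
  have -> : r ^+ 2 * (K ^+ 2 * rnorm (a - b) ^+ 2) = r * s * rnorm (a - b) ^+ 2.
    by rewrite -rK; ring.
  lra.
exists p; apply/eqP; rewrite -subr_eq0.
have : r%:C *: (T p - y) = 0.
  by move: fp => /eqP; rewrite /f -subr_eq0 addrC addKr oppr_eq0 => /eqP.
move=> /eqP; rewrite scaler_eq0 => /orP[|//].
by rewrite eq_complex/= gt_eqF.
Qed.

Lemma coercive_invertible : invertible T.
Proof.
have [T_lin T_bnd] := T_bounded.
pose Tl : {linear H -> H} := HB.pack T (GRing.isLinear.Build _ _ _ _ T T_lin).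
have T_inj : injective T.
  move=> a b Tab; apply/subr0_eq/rnorm_le0.
  rewrite -(pmulr_rle0 _ s_gt0) (le_trans (coercive_bounded_below _))//.
  have -> : T (a - b) = T a - T b := linearB Tl a b.
  by rewrite Tab subrr /rnorm normr0.
have [S TS] := choice coercive_surjective.
have ST : cancel T S by move=> x; apply: T_inj; rewrite TS.
have S_lin : linear S.
  by move=> a u v; apply: T_inj; rewrite TS T_lin !TS.
pose Sl : {linear H -> H} := HB.pack S (GRing.isLinear.Build _ _ _ _ S S_lin).
exists S; split=> //; split=> //.
apply/(linear_boundedP Sl); exists (s^-1)%:C; split.
  by apply/complex_realP; exists s^-1.
move=> c sc x; rewrite (le_trans _ (ler_wpM2r (normr_ge0 _) (ltW sc)))//.
rewrite !rnormE -rmorphM lecR ler_pdivlMl//.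
by rewrite -{2}(TS x) coercive_bounded_below.
Qed.

Lemma inverse_calA S : is_inverse T S -> calA (2 * s)%:C S.
Proof.
move=> [S_bounded ST TS]; split=> //; apply: ge_sup.
  by exists (complex.Re `|((2 * s)%:C *: S - idfun) 0|), 0 => //=; rewrite normr0.
move=> _ /= [y y1 <-].
have -> : ((2 * s)%:C *: S - idfun) y = (2 * s)%:C *: S y - T (S y).
  by rewrite TS.
rewrite -/(rnorm _) (le_trans (coercive_rnorm_le _))// TS.
by rewrite -lecR -rnormE.
Qed.

End Coercive.

Theorem theorem3p6 (R : realType) (H : completeNormedModType R[i])
    (dot : {dot H for Num.conj}) (dot_norm : induces_norm dot)
    (H_separable : separable_space H) (H_nontrivial : exists x : H, x != 0)
    (T : H -> H) (T_bounded : bounded_operators T) (T_neq0 : T <> 0)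
    (s : R) (s_gt0 : 0 < s)
    (ReT_ge : op_ge dot (op_Re dot T) (s%:C *: idfun)) :
  invertible T /\ calA (2 * s)%:C (op_inv T).
Proof.
have T_coercive := op_Re_coercive _ dot_norm _ _ s_gt0 ReT_ge.
have T_inv := coercive_invertible _ dot_norm _ T_bounded _ s_gt0 T_coercive.
split=> //.
exact: (inverse_calA _ dot_norm _ _ s_gt0 T_coercive _ (xgetPex _ T_inv)).
Qed.
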